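(* Up to isomorphism, there are exactly two connected strongly regular signed graphs that are $5$-regular and $1$ net-regular, namely $\dot G_2$ (complete, parameters $(6,5,-4,4)$) and $\dot S^1_{12}$ (parameters $(12,5,2,1,-2)$), defined in the context.
   Context: A signed graph $\dot G=(G,\sigma)$ is a simple graph $G$ with $\sigma:E(G)\to\{\pm1\}$; adjacency matrix $A_{\dot G}$ has entries $\sigma(v_iv_j)$ for adjacent vertices and $0$ otherwise. Degree and connectedness refer to $G$; the net-degree of $v$ is $d^+(v)-d^-(v)$ (numbers of positive minus negative incident edges); $\rho$ net-regular means every vertex has net-degree $\rho$. $\dot G$ on $n$ vertices is a strongly regular signed graph (SRSG) if it is neither a homogeneous (all edges of one sign) complete graph nor edgeless, and there exist $r\in\mathbb N$, $a,b,c\in\mathbb Z$ with $(A^2_{\dot G})_{ii}=r$, $(A^2_{\dot G})_{ij}=a$ whenever $v_iv_j$ is a positive edge, $b$ whenever it is a negative edge, and $c$ whenever $i\ne j$, $v_i\not\sim v_j$. Parameters are $(n,r,a,b,c)$ if non-complete, $(n,r,a,b)$ if complete. Isomorphism means sign-preserving graph isomorphism. $\dot G_2$ is $K_6$ whose negative edges form two vertex-disjoint triangles (so the positive edges form $K_{3,3}$). $\dot S^1_{12}$ has vertex set $\{(s,t): s\in\{1,2,3,4\}, t\in\{1,2,3\}\}$, with $(s,t)(s',t)$ a positive edge for all $s\ne s'$, $(s,t)(s,t')$ a negative edge for all $t\neq t'$, and no other edges (the Cartesian product $K_4\,\square\, K_3$ with the $K_4$-edges positive and the $K_3$-edges negative).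 *)

(* Defs.v *)
From HB Require Import structures.
From mathcomp Require Import all_boot all_order all_algebra.
Set Implicit Arguments. Unset Strict Implicit. Unset Printing Implicit Defensive.
Import Order.TTheory GRing.Theory Num.Theory.
Local Open Scope ring_scope.

(* A signed graph on a finite vertex type T is encoded by its adjacency
   matrix A : T -> T -> int, with entries in {-1,0,1}, symmetric, zero diagonal.
   x ~ y iff A x y != 0; the sign of the edge xy is A x y. *)
Definition is_signed_graph (T : finType) (A : T -> T -> int) : Prop :=
  (forall x, A x x = 0) /\ (forall x y, A x y = A y x) /\
  (forall x y, A x y \in [:: -1; 0; 1]).

Definition adj (T : finType) (A : T -> T -> int) : rel T := fun x y => A x y != 0.

Definition sq (T : finType) (A : T -> T -> int) (x y : T) : int :=
  \sum_(z : T) A x z * A z y.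

Definition degree (T : finType) (A : T -> T -> int) (x : T) : nat :=
  #|[set y | adj A x y]|.

Definition net_degree (T : finType) (A : T -> T -> int) (x : T) : int :=
  \sum_(y : T) A x y.

Definition regular (T : finType) (A : T -> T -> int) (k : nat) : Prop :=
  forall x, degree A x = k.

Definition net_regular (T : finType) (A : T -> T -> int) (rho : int) : Prop :=
  forall x, net_degree A x = rho.

Definition connected (T : finType) (A : T -> T -> int) : Prop :=
  forall x y, connect (adj A) x y.

Definition is_complete (T : finType) (A : T -> T -> int) : Prop :=
  forall x y, x != y -> adj A x y.

Definition homogeneous_complete (T : finType) (A : T -> T -> int) : Prop :=
  is_complete A /\
  ((forall x y, x != y -> A x y = 1) \/ (forall x y, x != y -> A x y = -1)).

Definition edgeless (T : finType) (A : T -> T -> int) : Prop :=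
  forall x y, A x y = 0.

(* The defining identities of an SRSG with parameters r, a, b, c
   (for a complete graph the c-condition is vacuous). *)
Definition srsg_params (T : finType) (A : T -> T -> int) (r : nat) (a b c : int) : Prop :=
  (forall x, sq A x x = r%:Z) /\
  (forall x y, A x y = 1 -> sq A x y = a) /\
  (forall x y, A x y = -1 -> sq A x y = b) /\
  (forall x y, x != y -> A x y = 0 -> sq A x y = c).

Definition SRSG (T : finType) (A : T -> T -> int) : Prop :=
  is_signed_graph A /\ ~ homogeneous_complete A /\ ~ edgeless A /\
  exists (r : nat) (a b c : int), srsg_params A r a b c.

Definition sg_iso (T T' : finType) (A : T -> T -> int) (B : T' -> T' -> int) : Prop :=
  exists f : T -> T', bijective f /\ forall x y, B (f x) (f y) = A x y.

(* G2: K6 on 'I_6; negative triangles {0,1,2} and {3,4,5}, positive K_{3,3}. *)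
Definition G2 : 'I_6 -> 'I_6 -> int := fun i j =>
  if i == j then 0 else if ((i < 3)%N == (j < 3)%N) then -1 else 1.

(* S^1_12 = K4 [] K3 on 'I_4 * 'I_3, K4-edges positive, K3-edges negative. *)
Definition S12 : 'I_4 * 'I_3 -> 'I_4 * 'I_3 -> int := fun u v =>
  if (u.2 == v.2) && (u.1 != v.1) then 1
  else if (u.1 == v.1) && (u.2 != v.2) then -1 else 0.

(* Main.v *)
(* Every vertex has three positive and two negative neighbours. For two distinct
   vertices x, y the entry of the square of A at (x, y) is prescribed (it is a, b or c),
   while an induced subgraph on a vertex list vs determines it up to the contribution of
   the common neighbours outside vs, whose number and signs are limited by the degrees
   still missing at x and y. Growing an induced subgraph from one vertex, always by a
   missing neighbour of its oldest unsaturated vertex, and discarding the subgraphs that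
   violate these bounds, is a finite search: it saturates after at most 12 vertices, and
   only in copies of G2 or S12. Only finitely many (a, b, c) are tried, because
   -4 <= (A^2)_xy <= 5 for all x, y; the row sums of A^2 moreover force
   3a + 2b + 4 + c(n - 6) = 0, which removes most of the long searches. *)
Require Import Defs.
From mathcomp Require Import all_boot all_order all_algebra.
From mathcomp Require Import zify.
Set Implicit Arguments. Unset Strict Implicit. Unset Printing Implicit Defensive.
Import Order.TTheory GRing.Theory Num.Theory.
Local Open Scope ring_scope.

(** * The finite search on partial adjacency matrices *)

Definition submx_of (T : eqType) (A : T -> T -> int) (vs : seq T) : seq (seq int) :=
  [seq [seq A x y | y <- vs] | x <- vs].

(* A plain [foldr], since the library's big operators do not compute. *)
Definition dot (r s : seq int) : int := foldr (fun p k => p.1 * p.2 + k) 0 (zip r s).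

Definition pos_deficit (r : seq int) : nat := (3 - count (pred1 1%R) r)%N.
Definition neg_deficit (r : seq int) : nat := (2 - count (pred1 (-1)%R) r)%N.

Definition target (a b c e : int) : int := if e == 1 then a else if e == -1 then b else c.

(* Whether the entry [t] of the square of A at two vertices with partial rows [r] and [s]
   can be reached: the common neighbours still to come contribute [t - dot r s]. *)
Definition pair_ok (t : int) (r s : seq int) : bool :=
  let k := t - dot r s in
  let: (p, n) := (pos_deficit r, neg_deficit r) in
  let: (p', n') := (pos_deficit s, neg_deficit s) in
  (k <= (minn p p' + minn n n')%:Z) && (- k <= (minn p n' + minn n p')%:Z).

Definition index_pairs (m : nat) : seq (nat * nat) :=
  [seq (i, j) | i <- iota 0 m, j <- iota i.+1 (m - i.+1)].

(* [find] stops at the first failing pair even under call by value; [all] would not. *)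
Definition consistent (a b c : int) (F : seq (seq int)) : bool :=
  let ps := index_pairs (size F) in
  (size ps <= find (fun ij => let: (i, j) := ij in
                     let r := nth [::] F i in
                     ~~ pair_ok (target a b c (nth 0%R r j)) r (nth [::] F j)) ps)%N.

(** What a new vertex may have as its entry at the vertex with row [r]. *)
Definition entries (r : seq int) : seq int :=
  0 :: (if (0 < pos_deficit r)%N then [:: 1] else [::])
    ++ (if (0 < neg_deficit r)%N then [:: -1] else [::]).

(* [p] and [n] are the numbers of entries 1 and -1 that may still be used. *)
Fixpoint rows (p n : nat) (D : seq (seq int)) : seq (seq int) :=
  if D is d :: D' then
    flatten [seq if e == 1 then if p is p'.+1 then [seq e :: r | r <- rows p' n D'] else [::]
                 else if e == -1 then if n is n'.+1 then [seq e :: r | r <- rows p n' D'] else [::]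
                 else [seq e :: r | r <- rows p n D'] | e <- d]
  else [:: [::]].

Definition extend (r : seq int) (F : seq (seq int)) : seq (seq int) :=
  (0 :: r) :: [seq e.1 :: e.2 | e <- zip r F].

(* New vertices are put in front, so the oldest unsaturated vertex is the last one. *)
Definition open_rows (F : seq (seq int)) : seq nat :=
  [seq i <- iota 0 (size F)
     | (0 < pos_deficit (nth [::] F i) + neg_deficit (nth [::] F i))%N].

(** Running out of fuel is a failure, so success certifies that every branch ends. Only rows with
    entry [e] at [u] are tried, because every completion contains such a neighbour of [u]. *)
Fixpoint search (leaf : pred (seq (seq int))) (a b c : int) (k : nat) (F : seq (seq int)) : bool :=
  if k is k'.+1 then
    if consistent a b c F then
      if open_rows F is i :: s then
        let u := last i s in
        let e : int := if (0 < pos_deficit (nth [::] F u))%N then 1 else -1 in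
        all (fun r => search leaf a b c k' (extend r F))
          (rows 3 2 (set_nth [::] [seq entries r | r <- F] u [:: e]))
      else leaf F
    else true
  else false.

(* Labels the vertices from the oldest to the newest by the first vertex of [V] with the
   right adjacencies. No backtracking is done: it happens not to be needed for G2 and S12. *)
Fixpoint greedy_labels (T : eqType) (B : T -> T -> int) (V : seq T)
    (F : seq (seq int)) (k : nat) : seq T :=
  if k is k'.+1 then
    let L := greedy_labels B V [seq behead r | r <- behead F] k' in
    if [seq v <- V | [seq B v w | w <- L] == behead (head [::] F)] is v :: _ then v :: L else L
  else [::].

(** Checks whatever [greedy_labels] proposes, so the labelling itself can be trusted without
    proof. *)
Definition is_copy (T : eqType) (B : T -> T -> int) (V : seq T) (F : seq (seq int)) : bool :=
  let L := greedy_labels B V F (size F) in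
  [&& uniq L, all [in L] V & F == submx_of B L].

(* [enum 'I_n] does not reduce, as it goes through the opaque [idP]. *)
Definition ords (n : nat) : seq 'I_n := pmap (insub_eq _) (iota 0 n).
Definition V12 : seq ('I_4 * 'I_3) := [seq (s, t) | s <- ords 4, t <- ords 3].

Definition is_example (F : seq (seq int)) : bool :=
  if size F == 6 then is_copy G2 (ords 6) F else is_copy S12 V12 F.

Definition values : seq int := [:: -4; -3; -2; -1; 0; 1; 2; 3; 4; 5].

(* [k] is the number of non-neighbours of a vertex; for [c != 0] it is at most
   |3 a + 2 b + 4|, hence the bound 35. *)
Definition feasible (a b c : int) : bool :=
  has (fun k : nat => 3 * a + 2 * b + 4 + c * k%:Z == 0) (iota 0 35).

(** * Soundness of the search *)

Lemma mem_rows p n (D : seq (seq int)) (r : seq int) :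
    all2 (fun e d => e \in d) r D ->
    (count (pred1 1%R) r <= p)%N -> (count (pred1 (-1)%R) r <= n)%N -> r \in rows p n D.
Proof.
elim: D p n r => [|d D IH] p n [|e r] //= /andP[ed rD] cp cn.
apply/flatten_mapP; exists e => //.
case: (@eqP _ e 1) cp cn => [->|_] /= cp cn.
  by case: p cp => [|p]; rewrite ?add1n // ltnS => cp; rewrite map_f // IH.
case: (@eqP _ e (-1)) cn => [->|_] /= cn; last by rewrite map_f // IH.
by case: n cn => [|n]; rewrite ?add1n // ltnS => cn; rewrite map_f // IH.
Qed.

Lemma count_card (T : finType) (P : pred T) (vs : seq T) :
  uniq vs -> count P vs = #|[set z | P z && (z \in vs)]|.
Proof.
move=> uvs; rewrite -size_filter.
have /card_uniqP <- : uniq [seq z <- vs | P z] by rewrite filter_uniq.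
by apply: eq_card => z; rewrite inE mem_filter.
Qed.

Section InducedSubgraphs.
Variables (T : finType) (A : T -> T -> int).
Hypothesis A_irr : forall x, A x x = 0.
Hypothesis A_sym : forall x y, A x y = A y x.
Hypothesis A_val : forall x y, A x y \in [:: -1; 0; 1].
Hypothesis pos3 : forall x, #|[set y | A x y == 1]| = 3%N.
Hypothesis neg2 : forall x, #|[set y | A x y == -1]| = 2%N.

Lemma outside_card (e : int) (x : T) (vs : seq T) : uniq vs ->
  #|[set z | (A x z == e) && (z \notin vs)]|
  = (#|[set z | A x z == e]| - count (pred1 e) [seq A x z | z <- vs])%N.
Proof.
move=> uvs; rewrite count_map count_card //.
rewrite -[#|[set z | A x z == e]|](cardsID [set z in vs]).
rewrite [X in (X + _ - _)%N](_ : _ = #|[set z | preim (A x) (pred1 e) z && (z \in vs)]|).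
  by rewrite addKn; apply: eq_card => z; rewrite !inE andbC.
by apply: eq_card => z; rewrite !inE.
Qed.

Lemma pos_deficitE x vs : uniq vs ->
  pos_deficit [seq A x z | z <- vs] = #|[set z | (A x z == 1) && (z \notin vs)]|.
Proof. by move=> uvs; rewrite outside_card // pos3. Qed.

Lemma neg_deficitE x vs : uniq vs ->
  neg_deficit [seq A x z | z <- vs] = #|[set z | (A x z == -1) && (z \notin vs)]|.
Proof. by move=> uvs; rewrite outside_card // neg2. Qed.

Lemma dotE x y (vs : seq T) :
  dot [seq A x z | z <- vs] [seq A y z | z <- vs] = \sum_(z <- vs) A x z * A z y.
Proof.
rewrite /dot zip_map; elim: vs => [|v vs IH] /=; first by rewrite big_nil.
by rewrite big_cons IH [A v y]A_sym.
Qed.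

(** A positive term requires [f z] and [g z] to be equal and nonzero; for each sign, the number of
    such [z] is at most either count. *)
Lemma sum_sign_le (f g : T -> int) (Q : pred T) :
    (forall z, f z \in [:: -1; 0; 1]) -> (forall z, g z \in [:: -1; 0; 1]) ->
  \sum_(z | Q z) f z * g z <=
    (minn #|[set z | (f z == 1) && Q z]| #|[set z | (g z == 1) && Q z]|
     + minn #|[set z | (f z == -1) && Q z]| #|[set z | (g z == -1) && Q z]|)%:Z.
Proof.
move=> fv gv.
pose S (e : int) := [set z | [&& f z == e, g z == e & Q z]].
have leS e : (#|S e| <= minn #|[set z | (f z == e) && Q z]| #|[set z | (g z == e) && Q z]|)%N.
  by rewrite leq_min; apply/andP; split; apply: subset_leq_card; apply/subsetP => z;
    rewrite !inE => /and3P[fe ge ->]; rewrite ?fe ?ge.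
apply: (@le_trans _ _ (#|S 1| + #|S (-1)|)%:Z); last by rewrite lez_nat leq_add.
rewrite PoszD -!sum1_card -!natz !natr_sum !(big_mkcond (fun z => z \in S _)) -big_split.
rewrite [leLHS]big_mkcond; apply: ler_sum => z _; rewrite !inE.
move: (fv z) (gv z); rewrite !inE => /or3P[]/eqP-> /or3P[]/eqP->; by case: (Q z).
Qed.

Lemma pair_ok_sq x y vs : uniq vs ->
  pair_ok (sq A x y) [seq A x z | z <- vs] [seq A y z | z <- vs].
Proof.
move=> uvs; rewrite /pair_ok dotE !pos_deficitE // !neg_deficitE //.
have -> : sq A x y - \sum_(z <- vs) A x z * A z y = \sum_(z | z \notin vs) A x z * A y z.
  rewrite /sq (bigID (mem vs)) /= -big_uniq //= addrAC subrr add0r.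
  by apply: eq_bigr => z _; rewrite [A z y]A_sym.
(* The lower bound is the upper bound for [A x] and [- A y], which swaps the two deficits of [y]. *)
have oppv z : - A y z \in [:: -1; 0; 1].
  by move: (A_val y z); rewrite !inE !eqr_oppLR opprK oppr0; do ?case: eqP.
apply/andP; split; first exact: sum_sign_le.
rewrite -sumrN; under eq_bigr => z _ do rewrite -mulrN.
have := sum_sign_le [pred z | z \notin vs] (A_val x) oppv.
have eN e : [set z | (- A y z == e) && (z \notin vs)] = [set z | (A y z == - e) && (z \notin vs)].
  by apply/setP => z; rewrite !inE eqr_oppLR.
by rewrite !eN opprK.
Qed.

Variables a b c : int.
Hypothesis sqE : forall x y, x != y -> sq A x y = target a b c (A x y).

Lemma nth_submx x0 vs i : (i < size vs)%N ->
  nth [::] (submx_of A vs) i = [seq A (nth x0 vs i) z | z <- vs].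
Proof. by move=> lti; rewrite (nth_map x0). Qed.

Lemma consistent_submx vs : uniq vs -> consistent a b c (submx_of A vs).
Proof.
case: vs => // x0 s; move: (x0 :: s) => vs uvs.
rewrite /consistent leqNgt -has_find -all_predC; apply/allP => -[i j].
case/allpairsPdep => i' [j' []]; rewrite !mem_iota size_map !add0n /= => lti.
rewrite subnKC // => ltj [-> ->].
have [ltij ltj'] := andP ltj.
rewrite negbK !(nth_submx x0) // (nth_map x0) // -sqE; first exact: pair_ok_sq.
by rewrite nth_uniq // neq_ltn ltij.
Qed.

Lemma extend_submx v vs : extend [seq A v z | z <- vs] (submx_of A vs) = submx_of A (v :: vs).
Proof.
rewrite /extend /submx_of zip_map /= A_irr -map_comp; congr (_ :: _).
by apply: eq_map => z /=; rewrite A_sym.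
Qed.

Lemma count_row_le e x vs : uniq vs ->
  (count (pred1 e) [seq A x z | z <- vs] <= #|[set z | A x z == e]|)%N.
Proof.
move=> uvs; rewrite count_map count_card //.
by apply: subset_leq_card; apply/subsetP => z; rewrite !inE => /andP[].
Qed.

Lemma mem_entries v y vs : uniq vs -> v \notin vs -> A v y \in entries [seq A y z | z <- vs].
Proof.
move=> uvs vnot; rewrite /entries pos_deficitE // neg_deficitE //.
have gt0 e : A v y = e -> (0 < #|[set z | (A y z == e) && (z \notin vs)]|)%N.
  by move=> ve; apply/card_gt0P; exists v; rewrite inE A_sym ve eqxx.
rewrite in_cons mem_cat.
by move: (A_val v y); rewrite !inE => /or3P[]/eqP ve; rewrite ?(gt0 _ ve) ve ?inE ?eqxx ?orbT.
Qed.

Lemma submx_extension u v vs : uniq vs -> v \notin vs -> (u < size vs)%N ->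
  [seq A v z | z <- vs]
    \in rows 3 2 (set_nth [::] [seq entries r | r <- submx_of A vs] u
                   [:: A v (nth v vs u)]).
Proof.
move=> uvs vnot ltu; apply: mem_rows; last 2 first.
- by rewrite -(pos3 v) count_row_le.
- by rewrite -(neg2 v) count_row_le.
rewrite all2E size_set_nth !size_map (maxn_idPr ltu) eqxx /=.
apply/(all_nthP (0, [::])) => i; rewrite size_zip size_set_nth !size_map (maxn_idPr ltu) minnn => lti.
rewrite nth_zip ?size_set_nth ?size_map ?(maxn_idPr ltu) //= (nth_map v) // nth_set_nth /=.
case: eqP => [->|_]; first by rewrite inE.
by rewrite -map_comp (nth_map v) //= mem_entries.
Qed.

(** Follows the branch that [A] itself realizes: induced subgraphs pass [consistent], and the row of
    a missing neighbour is among those tried. The branch ends at a list closed under adjacency. *)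
Lemma search_sound leaf k vs : uniq vs -> vs != [::] -> search leaf a b c k (submx_of A vs) ->
  exists ws, [/\ uniq ws, ws != [::], forall x y, x \in ws -> A x y != 0 -> y \in ws
               & leaf (submx_of A ws)].
Proof.
elim: k vs => // k IH vs uvs vs0 /=; rewrite consistent_submx //.
have x0 : T by case: vs vs0 {uvs}.
case Eo: (open_rows _) => [|i s].
  move=> lf; exists vs; split=> // x y xin xy; apply/negPn/negP => ynot.
  (* A neighbour outside [vs] would leave a deficit at [x]. *)
  have : index x vs \in open_rows (submx_of A vs).
    rewrite mem_filter mem_iota /= size_map index_mem xin andbT.
    rewrite (nth_submx x0) ?index_mem // nth_index // pos_deficitE // neg_deficitE //.
    rewrite addn_gt0; move: (A_val x y); rewrite !inE (negPf xy) /= => /orP[]/eqP ve.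
      by apply/orP; right; apply/card_gt0P; exists y; rewrite inE ve eqxx.
    by apply/orP; left; apply/card_gt0P; exists y; rewrite inE ve eqxx.
  by rewrite Eo.
have : last i s \in open_rows (submx_of A vs) by rewrite Eo mem_last.
set u := last i s; rewrite mem_filter mem_iota /= size_map => /andP[gt0 ltu].
move=> /allP srch; move: gt0 srch; rewrite (nth_submx x0) //; set x := nth x0 vs u.
set e : int := if _ then _ else _ => gt0 srch.
(* Deficits count neighbours outside [vs], so one of the sign chosen by the search exists. *)
have [v vnot ve] : exists2 v, v \notin vs & A v x = e.
  move: gt0; rewrite /e pos_deficitE // neg_deficitE // addn_gt0.
  case: ifP => [+ _|_] /= => /card_gt0P[v]; rewrite inE A_sym => /andP[/eqP ? ?]; by exists v.
apply: (IH (v :: vs)) => //; first by rewrite /= vnot.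
rewrite -extend_submx; apply: srch; rewrite -ve /x (set_nth_default v) //.
exact: submx_extension.
Qed.

(** * Bounds and row sums of the square *)

Lemma card_partition_sum (P1 P2 P3 P4 : pred T) (f : T -> int) (r1 r2 r3 r4 : int) :
  (forall y, f y = (if P1 y then r1 else 0) + (if P2 y then r2 else 0)
                   + (if P3 y then r3 else 0) + (if P4 y then r4 else 0)) ->
  \sum_y f y = r1 *+ #|P1| + r2 *+ #|P2| + r3 *+ #|P3| + r4 *+ #|P4|.
Proof.
move=> fE; under eq_bigr => y _ do rewrite fE.
by rewrite !big_split /= -!big_mkcond !sumr_const.
Qed.

(** The empty vertex list leaves all deficits at 3 and 2, which gives the bounds 3 + 2 = 5 and 2 + 2
    = 4. *)
Lemma sq_bounds x y : -4 <= sq A x y <= 5.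
Proof.
have : (sq A x y - 0 <= 5%:Z) && (- (sq A x y - 0) <= 4%:Z) := @pair_ok_sq x y [::] isT.
by rewrite subr0; lia.
Qed.

Lemma sq_diag x : sq A x x = 5.
Proof.
rewrite /sq (@card_partition_sum [pred z | A x z == 1] [pred z | A x z == -1] pred0 pred0 _ 1 1 0 0).
  rewrite -[#|[pred z | A x z == 1]|]cardsE -[#|[pred z | A x z == -1]|]cardsE.
  by rewrite pos3 neg2 !mul0rn !addr0.
by move=> z; rewrite [A z x]A_sym /=; move: (A_val x z); rewrite !inE => /or3P[]/eqP->.
Qed.

Hypothesis net1 : forall x, \sum_y A x y = 1.

(** The all-ones vector is fixed by A, hence by its square. A row of the square has one entry 5,
    three a, two b and k entries c, so 5 + 3a + 2b + ck = 1. *)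
Lemma row_sum_identity (x : T) : exists k : nat, 3 * a + 2 * b + 4 + c * k%:Z = 0.
Proof.
have sum1 : \sum_y sq A x y = 1.
  rewrite exchange_big /= -(net1 x); apply: eq_bigr => z _.
  by rewrite -mulr_sumr net1 mulr1.
exists #|[pred y | (x != y) && (A x y == 0)]|.
move: sum1; rewrite (@card_partition_sum (pred1 x) [pred y | A x y == 1] [pred y | A x y == -1]
    [pred y | (x != y) && (A x y == 0)] _ 5 a b c).
  rewrite card1 -[#|[pred z | A x z == 1]|]cardsE -[#|[pred z | A x z == -1]|]cardsE pos3 neg2.
  rewrite mulr1n -[a *+ 3]mulr_natl -[b *+ 2]mulr_natl -[c *+ _]mulr_natr (natz #|_|).
  by move: #|_| => k; lia.
move=> y /=; rewrite [y == x]eq_sym; case: eqP => [<-|/eqP xy]; first by rewrite sq_diag A_irr.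
by rewrite sqE // /target; move: (A_val x y); rewrite !inE => /or3P[]/eqP-> /=; lia.
Qed.

End InducedSubgraphs.

(** * Isomorphisms from equal matrices, and the outcome of the search *)

Lemma iso_of_submx (T T' : finType) (A : T -> T -> int) (B : T' -> T' -> int)
    (ws : seq T) (L : seq T') :
    ws != [::] -> uniq ws -> (forall x, x \in ws) -> uniq L -> (forall x, x \in L) ->
  submx_of A ws = submx_of B L -> sg_iso A B.
Proof.
move=> ws0 uws wsT uL LT eqm.
have szE : size ws = size L by have := congr1 size eqm; rewrite !size_map.
have [x0 y0] : T * T' by case: ws ws0 L szE {uws wsT uL LT eqm} => // x ws _ [|y L].
(* Vertices at equal positions of the two lists correspond. *)
exists (fun x => nth y0 L (index x ws)); split.
  exists (fun y => nth x0 ws (index y L)) => z.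
    by rewrite index_uniq ?nth_index -?szE ?index_mem.
  by rewrite index_uniq ?nth_index ?szE ?index_mem.
move=> x y; have ltx : (index x ws < size ws)%N by rewrite index_mem.
have lty : (index y ws < size ws)%N by rewrite index_mem.
have := congr1 (fun F => nth 0 (nth [::] F (index x ws)) (index y ws)) eqm.
rewrite /submx_of (nth_map x0) // (nth_map x0) // (nth_map y0) -?szE // (nth_map y0) -?szE //.
by rewrite !nth_index.
Qed.

Lemma mem_ords n (i : 'I_n) : i \in ords n.
Proof.
by rewrite /ords (eq_pmap (@insub_eqE _ _ _)) mem_ord_enum.
Qed.

Lemma uniq_ords n : uniq (ords n).
Proof. by rewrite /ords (eq_pmap (@insub_eqE _ _ _)) ord_enum_uniq. Qed.

Lemma mem_V12 x : x \in V12.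
Proof. by case: x => s t; apply: allpairs_f; apply: mem_ords. Qed.

Lemma uniq_V12 : uniq V12.
Proof. by apply: allpairs_uniq; rewrite ?uniq_ords // => -[? ?] [? ?]. Qed.

Lemma is_copy_iso (T T' : finType) (A : T -> T -> int) (B : T' -> T' -> int)
    (V : seq T') (ws : seq T) :
    (forall x, x \in V) -> ws != [::] -> uniq ws -> (forall x, x \in ws) ->
  is_copy B V (submx_of A ws) -> sg_iso A B.
Proof.
move=> VT ws0 uws wsT /and3P[uL /allP LV /eqP eqm].
by apply: iso_of_submx eqm => // x; apply: LV.
Qed.

(** Fuel 14 admits lists of up to 14 vertices. Under call by value an [if], unlike [==>], skips the
    search for infeasible triples. *)
Lemma search_succeeds : all (fun a => all (fun b => all (fun c =>
  if feasible a b c then search is_example a b c 14 [:: [:: 0]] else true) values) values) values.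
Proof. by vm_compute. Qed.

Lemma mem_values z : -4 <= z <= 5 -> z \in values.
Proof. by rewrite !inE; lia. Qed.

Lemma feasible_intro a b c : a \in values -> b \in values -> c \in values ->
  (exists k : nat, 3 * a + 2 * b + 4 + c * k%:Z = 0) -> feasible a b c.
Proof.
move=> av bv cv [k kE]; apply/hasP.
have [c0|c0] := eqVneq c 0.
  by exists 0%N => //; move: kE; rewrite c0 mulr0 mul0r => ->.
exists k; last by rewrite kE.
have abs_le z : z \in values -> -4 <= z <= 5 by rewrite !inE; lia.
move: (abs_le _ av) (abs_le _ bv) => /andP[? ?] /andP[? ?].
rewrite mem_iota; move: cv c0 kE; rewrite !inE.
(* Fixing each nonzero c makes the equation linear; as 3a + 2b + 4 lies between -16 and 29, it gives
   k <= 29. *)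
by do 9?[case/orP]; move/eqP=> -> // _ kE; lia.
Qed.

(** * The classification *)

Lemma signed_degrees (T : finType) (A : T -> T -> int) (x : T) : is_signed_graph A ->
    degree A x = 5%N -> net_degree A x = 1 ->
  #|[set y | A x y == 1]| = 3%N /\ #|[set y | A x y == -1]| = 2%N.
Proof.
move=> [_ [_ A_val]] deg net.
have dE : degree A x = (#|[set y | A x y == 1%R]| + #|[set y | A x y == (-1)%R]|)%N.
  rewrite /degree -cardsUI [X in (_ + X)%N]eq_card0 ?addn0 => [|y].
    apply: eq_card => y; rewrite !inE /adj.
    by move: (A_val x y); rewrite !inE => /or3P[]/eqP->.
  by rewrite !inE; case: eqP => // ->.
have nE : net_degree A x = #|[set y | A x y == 1]|%:Z - #|[set y | A x y == -1]|%:Z.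
  rewrite /net_degree -!sum1_card -!natz !natr_sum !(big_mkcond (fun y => y \in _)) -sumrB.
  by apply: eq_bigr => y _; rewrite !inE; move: (A_val x y); rewrite !inE => /or3P[]/eqP->.
(* The two signed degrees have sum 5 and difference 1. *)
by move: deg net; rewrite dE nE; lia.
Qed.

Lemma classification (T : finType) (A : T -> T -> int) :
    SRSG A -> connected A -> regular A 5 -> net_regular A 1 ->
  sg_iso A G2 \/ sg_iso A S12.
Proof.
move=> [sgA [_ [nonempty [r [a [b [c [_ [sq_a [sq_b sq_c]]]]]]]]]] conn reg net.
have [A_irr [A_sym A_val]] := sgA.
have pos3 x : #|[set y | A x y == 1]| = 3%N by have [] := signed_degrees sgA (reg x) (net x).
have neg2 x : #|[set y | A x y == -1]| = 2%N by have [] := signed_degrees sgA (reg x) (net x).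
have bnd x y : sq A x y \in values by apply: mem_values; apply: sq_bounds.
have [x0 _|T0] := pickP (@predT T); last by case: nonempty => x; have := T0 x.
have av : a \in values.
  have /card_gt0P[y] : (0 < #|[set y | A x0 y == 1%R]|)%N by rewrite pos3.
  by rewrite inE => /eqP/sq_a <-.
have bv : b \in values.
  have /card_gt0P[y] : (0 < #|[set y | A x0 y == (-1)%R]|)%N by rewrite neg2.
  by rewrite inE => /eqP/sq_b <-.
(* In the complete case [c] is unconstrained and may be replaced by 0. *)
have [c' c'v sq_c'] : exists2 c', c' \in values & forall x y, x != y -> A x y = 0 -> sq A x y = c'.
  have [[x y] /andP[/= xy /eqP Axy]|none] :=
      pickP [pred u : T * T | (u.1 != u.2) && (A u.1 u.2 == 0)].
    by exists c => //; rewrite -(sq_c _ _ xy Axy).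
  by exists 0 => // x y xy Axy; have := none (x, y); rewrite /= xy Axy.
have sqE x y : x != y -> sq A x y = target a b c' (A x y).
  move=> xy; rewrite /target; case: eqP => [/sq_a //|n1]; case: eqP => [/sq_b //|n2].
  by apply: sq_c' => //; move: (A_val x y); rewrite !inE => /or3P[]/eqP.
have feas : feasible a b c'.
  by apply: feasible_intro => //; apply: (row_sum_identity A_irr A_sym A_val pos3 neg2 sqE net x0).
have := search_succeeds => /allP/(_ _ av)/allP/(_ _ bv)/allP/(_ _ c'v); rewrite feas.
have -> : [:: [:: 0]] = submx_of A [:: x0] by rewrite /submx_of /= A_irr.
case/(search_sound A_irr A_sym A_val pos3 neg2 sqE) => // ws [uws ws0 cl lf].
(* [ws] is nonempty and closed under adjacency, so connectedness makes it exhaust [T]. *)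
have path_in p z : z \in ws -> path (adj A) z p -> last z p \in ws.
  by elim: p z => //= y p IH z zin /andP[/(cl _ _ zin) yin]; apply: IH.
have wsT x : x \in ws.
  have [x1 x1in] : exists x1, x1 \in ws.
    by case: ws ws0 {uws lf cl path_in} => // y s _; exists y; exact: mem_head.
  by have /connectP[p pth ->] := conn x1 x; apply: path_in pth.
move: lf; rewrite /is_example; case: ifP => _ lf; [left|right].
  exact: (is_copy_iso (@mem_ords 6) ws0 uws wsT lf).
exact: (is_copy_iso mem_V12 ws0 uws wsT lf).
Qed.

(** * Verification of the two examples *)

Section ExplicitVertexList.
Variables (T : finType) (B : T -> T -> int) (V : seq T).
Hypotheses (uV : uniq V) (VT : forall x, x \in V).

(** Replaces sums over the type by sums over an explicit list, which can then be evaluated. *)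
Lemma sum_list (F : T -> int) : \sum_x F x = \sum_(x <- V) F x.
Proof. by rewrite [RHS]big_uniq //=; apply: eq_bigl => x; rewrite VT. Qed.

Lemma allV (P : pred T) : all P V -> forall x, P x.
Proof. by move=> /allP h x; apply: h. Qed.

Lemma signed_graph_check :
  all (fun x => all (fun y => [&& B x x == 0, B x y == B y x & B x y \in [:: -1; 0; 1]]) V) V ->
  is_signed_graph B.
Proof.
move=> chk; have h x y := allV (allV chk x) y.
by split=> [x|]; [|split=> x y]; [have /and3P[/eqP] := h x x | have /and3P[_ /eqP] := h x y
  | have /and3P[] := h x y].
Qed.

Lemma srsg_params_check (r : nat) (a b c : int) : is_signed_graph B ->
  all (fun x => all (fun y => dot [seq B x z | z <- V] [seq B y z | z <- V]
         == if x == y then r%:Z else target a b c (B x y)) V) V ->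
  srsg_params B r a b c.
Proof.
move=> [B_irr [B_sym _]] chk.
have h x y : sq B x y = if x == y then r%:Z else target a b c (B x y).
  by rewrite /sq sum_list -dotE //; apply/eqP; apply: (allV (allV chk x)).
split=> [x|]; first by rewrite h eqxx.
split=> [x y xy|]; last split=> [x y xy|x y /negPf xy xy0]; rewrite h ?xy ?xy0 //;
  by case: eqP xy => // ->; rewrite B_irr.
Qed.

Lemma regular_check k : all (fun x => count (adj B x) V == k) V -> regular B k.
Proof.
move=> chk x; rewrite /degree -(eqP (allV chk x)) count_card //.
by apply: eq_card => y; rewrite !inE VT andbT.
Qed.

Lemma net_regular_check rho :
  all (fun x => foldr +%R 0 [seq B x y | y <- V] == rho) V -> net_regular B rho.
Proof.
move=> chk x; rewrite /net_degree sum_list -(eqP (allV chk x)).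
by rewrite foldrE big_map.
Qed.

End ExplicitVertexList.

Lemma G2_complete : is_complete G2.
Proof. by move=> x y xy; rewrite /adj /G2 (negPf xy); case: ifP. Qed.

Lemma G2_signed : is_signed_graph G2.
Proof. by apply: (signed_graph_check (@mem_ords 6)); vm_compute. Qed.

(** Off the diagonal of a complete graph [target] never returns c, so the check evaluates with c a
    variable. *)
Lemma G2_params c : srsg_params G2 5 (-4) 4 c.
Proof. by apply: (srsg_params_check (uniq_ords 6) (@mem_ords 6) G2_signed); vm_compute. Qed.

Lemma S12_signed : is_signed_graph S12.
Proof. by apply: (signed_graph_check mem_V12); vm_compute. Qed.

Lemma S12_params : srsg_params S12 5 2 1 (-2).
Proof. by apply: (srsg_params_check uniq_V12 mem_V12 S12_signed); vm_compute. Qed.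

Lemma S12_connected : connected S12.
Proof.
move=> [s t] [s' t']; apply: (@connect_trans _ _ (s', t)).
  have [->|ss'] := eqVneq s s'; first exact: connect0.
  by apply: connect1; rewrite /adj /S12 /= eqxx ss'.
have [->|tt'] := eqVneq t t'; first exact: connect0.
by apply: connect1; rewrite /adj /S12 /= eqxx (negPf tt').
Qed.

Lemma G2_connected : connected G2.
Proof.
move=> x y; have [->|xy] := eqVneq x y; first exact: connect0.
by apply: connect1; apply: G2_complete.
Qed.

Theorem theorem3p11 :
  (* the two examples are SRSGs with the stated parameters *)
  (SRSG G2 /\ is_complete G2 /\ forall c : int, srsg_params G2 5 (-4) 4 c) /\
  (SRSG S12 /\ ~ is_complete S12 /\ srsg_params S12 5 2 1 (-2)) /\
  (* they are non-isomorphic *)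
  ~ sg_iso G2 S12 /\
  (* classification *)
  (forall (T : finType) (A : T -> T -> int),
     SRSG A -> connected A -> regular A 5 -> net_regular A 1 ->
     sg_iso A G2 \/ sg_iso A S12) /\
  (* and both examples satisfy the hypotheses *)
  (connected G2 /\ regular G2 5 /\ net_regular G2 1) /\
  (connected S12 /\ regular S12 5 /\ net_regular S12 1).
Proof.
have G2_not_homogeneous : ~ homogeneous_complete G2.
  (* Vertices 0 and 1 share a negative triangle, while 0 and 5 are joined by a positive edge. *)
  case=> _ [h|h]; first by have := h ord0 (@Ordinal 6 1 isT) isT.
  by have := h ord0 ord_max isT.
have S12_not_complete : ~ is_complete S12.
  by move=> h; have := h (ord0, ord0) (ord_max, ord_max) isT.
split; [|split; [|split; [|split; [|split]]]].
- split; [split; [exact: G2_signed | split=> //; split]|split].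
  + by move=> h; have := h ord0 ord_max.
  + by exists 5%N, (-4), 4, 0; apply: G2_params.
  + exact: G2_complete.
  + exact: G2_params.
- split; [split; [exact: S12_signed | split; [by case|split]]|split=> //].
  + by move=> h; have := h (ord0, ord0) (ord0, ord_max).
  + by exists 5%N, 2, 1, (-2); apply: S12_params.
  + exact: S12_params.
- by case=> f [/bij_eq_card]; rewrite card_prod !card_ord.
- exact: classification.
- split; [exact: G2_connected | split].
    by apply: (regular_check (uniq_ords 6) (@mem_ords 6)); vm_compute.
  by apply: (net_regular_check (uniq_ords 6) (@mem_ords 6)); vm_compute.
- split; [exact: S12_connected | split].
    by apply: (regular_check uniq_V12 mem_V12); vm_compute.
  by apply: (net_regular_check uniq_V12 mem_V12); vm_compute.
Qed.
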